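(* Let $\mathbf{P}_B(\xi_0)$ be the BiMPC problem and $\mathbf{P}_{IP}(\xi_0)$ its integer-programming reformulation with constant $\kappa>0$, both defined in the context. Let $\arg\min\mathbf{P}_{IP}(\xi_0)$ denote the set of $(\boldsymbol\xi,\mathbf{u},\mathbf{w})$-components of its minimizers. Then, for all sufficiently large $\kappa$, $$\arg\min\mathbf{P}_B(\xi_0)=\arg\min\mathbf{P}_{IP}(\xi_0).$$
   Context: Notation: for an integer $r\ge 1$, $\langle r\rangle=\{0,\dots,r-1\}$ and $[r]=\{1,\dots,r\}$ ($[0]=\emptyset$); $\mathbb{I}$ is the identity; vector inequalities are componentwise. System. Let $A\in\mathbb{R}^{p\times p}$, $B\in\mathbb{R}^{p\times q}$; the dynamics are $\xi_{n+1}=A\xi_n+B\nu_n$ with state $\xi=(x,y)$, $x\in\mathbb{R}^\rho$, $y\in\mathbb{R}^{p-\rho}$, and input $\nu=(u,w)$, $u\in\mathbb{R}^\gamma$, $w\in\mathbb{R}^{q-\gamma}$. Write $B=[B_1\ B_2]$ with $B_1\in\mathbb{R}^{p\times\gamma}$, $B_2\in\mathbb{R}^{p\times(q-\gamma)}$. The sets $\mathcal{X}=\{x:F_xx\le g_x\}\subset\mathbb{R}^\rho$, $\mathcal{Y}=\{y:F_yy\le g_y\}\subset\mathbb{R}^{p-\rho}$, $\mathcal{U}=\{u:F_uu\le g_u\}\subset\mathbb{R}^\gamma$, $\mathcal{W}=\{w:F_ww\le g_w\}\subset\mathbb{R}^{q-\gamma}$ are compact, non-singleton polytopes containing the origin.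 The matrices $U,V\in\mathbb{R}^{p\times p}$ are positive semidefinite, and $W=\begin{bmatrix}W_1&\Phi\\ \Phi^{\mathsf T}&W_2\end{bmatrix}\in\mathbb{R}^{q\times q}$ with $\Phi\in\mathbb{R}^{\gamma\times(q-\gamma)}$ and $W_2\in\mathbb{R}^{(q-\gamma)\times(q-\gamma)}$ positive definite. $N\ge1$ is a finite horizon; $\boldsymbol\xi=(\xi_1,\dots,\xi_N)$, $\mathbf{u}=(u_0,\dots,u_{N-1})$, $\mathbf{w}=(w_0,\dots,w_{N-1})$, $\xi_n=(x_n,y_n)$, $\nu_n=(u_n,w_n)$. Terminal set. For a given $K_L\in\mathbb{R}^{(q-\gamma)\times p}$, $\mathcal{Y}_\Omega=\{y:F_oy\le g_o\}\subseteq\mathbb{R}^{p-\rho}$ is such that (i) $\mathcal{Y}_\Omega\subseteq\mathcal{Y}$ and $K_L\xi\in\mathcal{W}$ whenever $(x,y)\in\mathcal{X}\times\mathcal{Y}_\Omega$; (ii) the $y$-component of $(A+B_2K_L)\xi+B_1u$ lies in $\mathcal{Y}_\Omega$ whenever $(x,y,u)\in\mathcal{X}\times\mathcal{Y}_\Omega\times\mathcal{U}$. LoMPC. Given $\xi_0$ and $\mathbf{u}$, $\mathbf{P}_L(\xi_0,\mathbf{u})$ is the problem of minimizing over $(\boldsymbol\xi,\mathbf{w})$ the cost $\xi_N^{\mathsf T}U\xi_N+\sum_{n=0}^{N-1}(\xi_n^{\mathsf T}V\xi_n+\nu_n^{\mathsf T}W\nu_n)$ subject to $\xi_{n+1}=A\xi_n+B\nu_n$,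 $y_n\in\mathcal{Y}$, $w_n\in\mathcal{W}$ for $n\in\langle N\rangle$, and $y_N\in\mathcal{Y}_\Omega$. The matrix $H$. Set $\Lambda_N=U$ and, for $n\in[N]$ (backward recursion), $\Theta_n=W_2+B_2^{\mathsf T}\Lambda_nB_2$, $\Lambda_{n-1}=A^{\mathsf T}\Lambda_nA-A^{\mathsf T}\Lambda_nB_2\Theta_n^{-1}B_2^{\mathsf T}\Lambda_nA+V$; let $\Gamma=\mathbb{I}-B_2\Theta_1^{-1}B_2^{\mathsf T}\Lambda_1$. Let $G\in\mathbb{R}^{\gamma\times p}$ be such that $Z=\Gamma A+(\Gamma B_1-B_2\Theta_1^{-1}\Phi^{\mathsf T})G$ is Schur stable (all eigenvalues of modulus $<1$), and let $H$ be the unique positive definite solution of $Z^{\mathsf T}HZ-H=-\mathbb{I}$. BiMPC. Let $P,Q\in\mathbb{R}^{p\times p}$, $R\in\mathbb{R}^{q\times q}$ be positive semidefinite. $\mathbf{P}_B(\xi_0)$ is the problem of minimizing over $(\boldsymbol\xi,\mathbf{u},\mathbf{w})$ the cost $\xi_N^{\mathsf T}P\xi_N+\sum_{n=0}^{N-1}(\xi_n^{\mathsf T}Q\xi_n+\nu_n^{\mathsf T}R\nu_n)$ subject to: $(\boldsymbol\xi,\mathbf{w})$ is a minimizer of $\mathbf{P}_L(\xi_0,\mathbf{u})$; $\xi_1^{\mathsf T}H\xi_1-\xi_0^{\mathsf T}(H-\mathbb{I})\xi_0\le 0$; $x_n\in\mathcal{X}$, $u_n\in\mathcal{U}$ for $n\in\langle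 N\rangle$; $x_N\in\mathcal{X}$. Integer-programming reformulation. Let $\kappa>0$. Let $\boldsymbol\mu=(\mu_0,\dots,\mu_{N-1})$, $\boldsymbol\lambda=(\lambda_0,\dots,\lambda_N)$, $\boldsymbol\gamma=(\gamma_0,\dots,\gamma_{N-1})$, $\boldsymbol\sigma=(\sigma_0,\dots,\sigma_N)$, $\boldsymbol\tau=(\tau_0,\dots,\tau_{N-1})$ be collections of vectors of appropriate dimensions ($\sigma_n$ of the size of $\lambda_n$, $\tau_n$ of the size of $\gamma_n$), and let $\bar F_y=[0\ F_y]$, $\bar F_o=[0\ F_o]$, so that $\bar F_y\xi=F_yy$, $\bar F_o\xi=F_oy$. In expressions $1-\sigma_n$, $1-\tau_n$, $1$ is the all-ones vector. $\mathbf{P}_{IP}(\xi_0)$ is the problem of minimizing over $(\boldsymbol\xi,\mathbf{u},\mathbf{w},\boldsymbol\mu,\boldsymbol\lambda,\boldsymbol\gamma,\boldsymbol\sigma,\boldsymbol\tau)$ the cost $\xi_N^{\mathsf T}P\xi_N+\sum_{n=0}^{N-1}(\xi_n^{\mathsf T}Q\xi_n+\nu_n^{\mathsf T}R\nu_n)$ subject to - $2U\xi_N+\mu_{N-1}+\bar F_o^{\mathsf T}\lambda_N=0$; - $2V\xi_n+\mu_{n-1}-A^{\mathsf T}\mu_n+\bar F_y^{\mathsf T}\lambda_n=0$ for $n\in[N-1]$; - $2W_2w_n+2\Phi^{\mathsf T}u_n-B_2^{\mathsf T}\mu_n+F_w^{\mathsf T}\gamma_n=0$ for $n\in\langle N\rangle$;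 - $\lambda_n\le\kappa\sigma_n$ and $F_yy_n-g_y\ge-\kappa(1-\sigma_n)$ for $n\in\langle N\rangle$; - $\lambda_N\le\kappa\sigma_N$ and $F_oy_N-g_o\ge-\kappa(1-\sigma_N)$; - $\gamma_n\le\kappa\tau_n$ and $F_ww_n-g_w\ge-\kappa(1-\tau_n)$ for $n\in\langle N\rangle$; - $\xi_{n+1}=A\xi_n+B\nu_n$ for $n\in\langle N\rangle$; - $\xi_1^{\mathsf T}H\xi_1-\xi_0^{\mathsf T}(H-\mathbb{I})\xi_0\le0$; - $F_xx_n\le g_x$, $F_yy_n\le g_y$, $F_uu_n\le g_u$, $F_ww_n\le g_w$ for $n\in\langle N\rangle$; - $F_xx_N\le g_x$, $F_oy_N\le g_o$; - $\lambda_n\ge0$, $\gamma_n\ge0$ for $n\in\langle N\rangle$, and $\lambda_N\ge0$; - all entries of $\boldsymbol\sigma,\boldsymbol\tau$ are in $\{0,1\}$. *)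

(* Defs.v *)
From mathcomp Require Import all_boot all_order all_algebra.
From mathcomp Require Import complex.
From mathcomp Require Import all_classical all_reals all_analysis.

Set Implicit Arguments.
Unset Strict Implicit.
Unset Printing Implicit Defensive.

Import Order.TTheory GRing.Theory Num.Theory.
Import numFieldNormedType.Exports.
Local Open Scope classical_set_scope.
Local Open Scope ring_scope.

Definition argmin (R : realType) (T : Type) (S : set T) (f : T -> R) : set T :=
  [set z | S z /\ forall z', S z' -> f z <= f z'].

Section Matrices.
Context {R : realType}.

Definition vle m (a b : 'cV[R]_m) : Prop := forall i, a i 0 <= b i 0.

Definition qform n (M : 'M[R]_n) (v : 'cV[R]_n) : R := (v^T *m M *m v) 0 0.

Definition psdmx n (M : 'M[R]_n) : Prop :=
  M^T = M /\ forall v, 0 <= qform M v.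

Definition pdmx n (M : 'M[R]_n) : Prop :=
  M^T = M /\ forall v, v != 0 -> 0 < qform M v.

Definition schur_stable n (Z : 'M[R]_n) : Prop :=
  forall a : R[i], eigenvalue (map_mx (real_complex R) Z) a -> `|a| < 1.

Definition binary m (s : 'cV[R]_m) : Prop := forall i, s i 0 = 0 \/ s i 0 = 1.

Definition polyhedron m n (F : 'M[R]_(m, n)) (g : 'cV[R]_m) : set 'cV[R]_n :=
  [set v | vle (F *m v) g].

End Matrices.

Infix "<=v" := vle (at level 70, no associativity).

(* The state is xi = col_mx x y with x of size rho and y of size eta (eta is
   p - rho), the input is nu = col_mx u w with u of size gam and w of size om
   (om is q - gam).  The remaining indices are the numbers of linear
   inequalities that describe X, Y, U, W and Y_Omega.  The symbols U, V, W1,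
   Phi, W2 belong to the lower-level cost and P, Q, R to the upper-level
   cost. *)
Record bimpc_data (R : realType) (rho eta gam om mx my mu mw mo : nat) :=
  BiMPCData {
    stA : 'M[R]_(rho + eta);
    inB1 : 'M[R]_(rho + eta, gam);
    inB2 : 'M[R]_(rho + eta, om);
    Fx : 'M[R]_(mx, rho);  gx : 'cV[R]_mx;
    Fy : 'M[R]_(my, eta);  gy : 'cV[R]_my;
    Fu : 'M[R]_(mu, gam);  gu : 'cV[R]_mu;
    Fw : 'M[R]_(mw, om);   gw : 'cV[R]_mw;
    Fo : 'M[R]_(mo, eta);  go : 'cV[R]_mo;
    loU : 'M[R]_(rho + eta);
    loV : 'M[R]_(rho + eta);
    loW1 : 'M[R]_gam;
    loPhi : 'M[R]_(gam, om);
    loW2 : 'M[R]_om;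
    upP : 'M[R]_(rho + eta);
    upQ : 'M[R]_(rho + eta);
    upR : 'M[R]_(gam + om)
  }.

Section Problems.
Context {R : realType} {rho eta gam om mx my mu mw mo : nat}.
Context (D : bimpc_data R rho eta gam om mx my mu mw mo).

Local Notation p := (rho + eta)%N.
Local Notation q := (gam + om)%N.

Definition inB : 'M[R]_(p, q) := row_mx (inB1 D) (inB2 D).
Definition loW : 'M[R]_q :=
  block_mx (loW1 D) (loPhi D) (loPhi D)^T (loW2 D).

Definition Xset : set 'cV[R]_rho := polyhedron (Fx D) (gx D).
Definition Yset : set 'cV[R]_eta := polyhedron (Fy D) (gy D).
Definition Uset : set 'cV[R]_gam := polyhedron (Fu D) (gu D).
Definition Wset : set 'cV[R]_om := polyhedron (Fw D) (gw D).
Definition Yoset : set 'cV[R]_eta := polyhedron (Fo D) (go D).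

Definition terminal_set (KL : 'M[R]_(om, p)) : Prop :=
  [/\ Yoset `<=` Yset,
      forall x y, Xset x -> Yoset y -> Wset (KL *m col_mx x y) &
      forall x y u, Xset x -> Yoset y -> Uset u ->
        Yoset (dsubmx ((stA D + inB2 D *m KL) *m col_mx x y + inB1 D *m u))].

Context (N : nat).

(* For a tuple, 0-based indexing is used throughout: u_n is u`_n and, since
   xi = (xi_1, ..., xi_N) does not contain xi_0, xi_n is traj xi0 xi n. *)
Definition traj (xi0 : 'cV[R]_p) (xi : N.-tuple 'cV[R]_p) (n : nat) : 'cV[R]_p :=
  (xi0 :: xi)`_n.

Definition input (u : N.-tuple 'cV[R]_gam) (w : N.-tuple 'cV[R]_om) (n : nat) :
    'cV[R]_q :=
  col_mx u`_n w`_n.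

Definition dynamics xi0 (xi : N.-tuple 'cV[R]_p) u w : Prop :=
  forall n, (n < N)%N ->
    traj xi0 xi n.+1 = stA D *m traj xi0 xi n + inB *m input u w n.

Definition cost (MT MS : 'M[R]_p) (MI : 'M[R]_q)
    xi0 (xi : N.-tuple 'cV[R]_p) u w : R :=
  qform MT (traj xi0 xi N) +
  \sum_(0 <= n < N) (qform MS (traj xi0 xi n) + qform MI (input u w n)).

Definition PL_feasible xi0 u :
    set (N.-tuple 'cV[R]_p * N.-tuple 'cV[R]_om) :=
  [set z | let: (xi, w) := z in
    [/\ dynamics xi0 xi u w,
        forall n, (n < N)%N ->
          Yset (dsubmx (traj xi0 xi n)) /\ Wset w`_n &
        Yoset (dsubmx (traj xi0 xi N))]].

Definition argmin_PL xi0 u : set (N.-tuple 'cV[R]_p * N.-tuple 'cV[R]_om) :=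
  argmin (PL_feasible xi0 u)
    (fun z => cost (loU D) (loV D) loW xi0 z.1 u z.2).

Definition Theta_of (L : 'M[R]_p) : 'M[R]_om :=
  loW2 D + (inB2 D)^T *m L *m inB2 D.

Definition riccati_step (L : 'M[R]_p) : 'M[R]_p :=
  (stA D)^T *m L *m stA D
  - (stA D)^T *m L *m inB2 D *m invmx (Theta_of L)
      *m (inB2 D)^T *m L *m stA D
  + loV D.

(* meant for n <= N *)
Definition Lambda (n : nat) : 'M[R]_p := iter (N - n) riccati_step (loU D).
Definition Theta (n : nat) : 'M[R]_om := Theta_of (Lambda n).

Definition Gamma : 'M[R]_p :=
  1%:M - inB2 D *m invmx (Theta 1) *m (inB2 D)^T *m Lambda 1.

Definition Zmx (G : 'M[R]_(gam, p)) : 'M[R]_p :=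
  Gamma *m stA D
  + (Gamma *m inB1 D - inB2 D *m invmx (Theta 1) *m (loPhi D)^T) *m G.

Context (H : 'M[R]_p).

Definition lyap_decrease xi0 (xi : N.-tuple 'cV[R]_p) : Prop :=
  qform H (traj xi0 xi 1) - qform (H - 1%:M) (traj xi0 xi 0) <= 0.

(* the triples (xi, u, w) *)
Definition primal : Type :=
  (N.-tuple 'cV[R]_p * N.-tuple 'cV[R]_gam * N.-tuple 'cV[R]_om)%type.

Definition upper_cost xi0 (z : primal) : R :=
  let: (xi, u, w) := z in cost (upP D) (upQ D) (upR D) xi0 xi u w.

Definition PB_feasible xi0 : set primal :=
  [set z | let: (xi, u, w) := z in
    [/\ argmin_PL xi0 u (xi, w),
        lyap_decrease xi0 xi,
        forall n, (n < N)%N -> Xset (usubmx (traj xi0 xi n)) /\ Uset u`_n &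
        Xset (usubmx (traj xi0 xi N))]].

Definition argmin_PB xi0 : set primal :=
  argmin (PB_feasible xi0) (upper_cost xi0).

(* The terminal multiplier lambda_N and its indicator sigma_N have the number
   of rows of Fo and not that of Fy, hence they are separate fields. *)
Record ip_aux := IPAux {
  ip_mu : N.-tuple 'cV[R]_p;
  ip_lam : N.-tuple 'cV[R]_my;
  ip_lamN : 'cV[R]_mo;
  ip_gam : N.-tuple 'cV[R]_mw;
  ip_sig : N.-tuple 'cV[R]_my;
  ip_sigN : 'cV[R]_mo;
  ip_tau : N.-tuple 'cV[R]_mw
}.

Definition barFy : 'M[R]_(my, p) := row_mx 0 (Fy D).
Definition barFo : 'M[R]_(mo, p) := row_mx 0 (Fo D).

Definition stationarity xi0 (z : primal) (d : ip_aux) : Prop :=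
  let: (xi, u, w) := z in
  [/\ 2 *: (loU D *m traj xi0 xi N) + (ip_mu d)`_N.-1
        + barFo^T *m ip_lamN d = 0,
      forall n, (1 <= n <= N.-1)%N ->
        2 *: (loV D *m traj xi0 xi n) + (ip_mu d)`_n.-1
          - (stA D)^T *m (ip_mu d)`_n + barFy^T *m (ip_lam d)`_n = 0 &
      forall n, (n < N)%N ->
        2 *: (loW2 D *m w`_n) + 2 *: ((loPhi D)^T *m u`_n)
          - (inB2 D)^T *m (ip_mu d)`_n + (Fw D)^T *m (ip_gam d)`_n = 0].

Definition big_M (kappa : R) xi0 (z : primal) (d : ip_aux) : Prop :=
  let: (xi, u, w) := z in
  [/\ forall n, (n < N)%N ->
        (ip_lam d)`_n <=v kappa *: (ip_sig d)`_n /\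
        - (kappa *: (const_mx 1 - (ip_sig d)`_n))
          <=v Fy D *m dsubmx (traj xi0 xi n) - gy D,
      ip_lamN d <=v kappa *: ip_sigN d /\
        - (kappa *: (const_mx 1 - ip_sigN d))
          <=v Fo D *m dsubmx (traj xi0 xi N) - go D &
      forall n, (n < N)%N ->
        (ip_gam d)`_n <=v kappa *: (ip_tau d)`_n /\
        - (kappa *: (const_mx 1 - (ip_tau d)`_n))
          <=v Fw D *m w`_n - gw D].

Definition ip_primal_constraints xi0 (z : primal) : Prop :=
  let: (xi, u, w) := z in
  [/\ dynamics xi0 xi u w,
      lyap_decrease xi0 xi,
      forall n, (n < N)%N ->
        [/\ Fx D *m usubmx (traj xi0 xi n) <=v gx D,
            Fy D *m dsubmx (traj xi0 xi n) <=v gy D,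
            Fu D *m u`_n <=v gu D &
            Fw D *m w`_n <=v gw D],
      Fx D *m usubmx (traj xi0 xi N) <=v gx D &
      Fo D *m dsubmx (traj xi0 xi N) <=v go D].

Definition ip_sign_constraints (d : ip_aux) : Prop :=
  [/\ forall n, (n < N)%N -> 0 <=v (ip_lam d)`_n /\ 0 <=v (ip_gam d)`_n,
      0 <=v ip_lamN d,
      forall n, (n < N)%N -> binary (ip_sig d)`_n /\ binary (ip_tau d)`_n &
      binary (ip_sigN d)].

Definition PIP_feasible (kappa : R) xi0 : set (primal * ip_aux) :=
  [set zd | [/\ stationarity xi0 zd.1 zd.2, big_M kappa xi0 zd.1 zd.2,
                ip_primal_constraints xi0 zd.1 & ip_sign_constraints zd.2]].

Definition argmin_PIP (kappa : R) xi0 : set primal :=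
  fst @` argmin (PIP_feasible kappa xi0) (fun zd => upper_cost xi0 zd.1).

End Problems.

Arguments argmin_PB {R rho eta gam om mx my mu mw mo} D N H xi0.
Arguments argmin_PIP {R rho eta gam om mx my mu mw mo} D N H kappa xi0.

Definition polytope_with_origin (R : realType) n (S : set 'cV[R]_n) : Prop :=
  [/\ compact S, ~ (exists v, S = [set v]) & S 0].

(* Main.v *)
Require Import Defs.
From mathcomp Require Import all_boot all_order all_algebra.
From mathcomp Require Import complex.
From mathcomp Require Import all_classical all_reals all_analysis.
From mathcomp Require Import ring zify.
Import Order.TTheory GRing.Theory Num.Theory.
Import numFieldNormedType.Exports.
Local Open Scope classical_set_scope.
Local Open Scope ring_scope.

Set Implicit Arguments.
Unset Strict Implicit.
Unset Printing Implicit Defensive.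

(** Both problems minimize the same cost of (xi, u, w), so it is enough that,
    for large kappa, the feasible set of the bilevel problem is the projection
    of the feasible set of the integer program ([argmin_projection]).  The
    integer program is the bilevel problem with the optimality of (xi, w) for
    the lower-level problem replaced by its KKT conditions, complementarity
    being encoded by binary variables and the constant kappa.

    KKT conditions imply optimality, for every kappa
    ([PIP_feasible_PB_feasible]).  Once u is fixed, the lower-level problem is a
    convex quadratic program in the perturbation v of w: the perturbation of the
    states is the linear response to v, and the cost changes by a linear term
    [gradient] plus a nonnegative quadratic term [curvature].  The multipliers
    mu_n of the dynamics are a costate; summation by parts ([costate_sum])
    eliminates them and turns stationarity into the identity of linear
    functionals [gradient + sum_i lambda_i slope_i = 0].

    Conversely an optimal (xi, w) has KKT multipliers by Farkas' lemma
    ([farkas], [qp_kkt_bounded]), and the costate is recovered by the backward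
    recursion ([lagrangian_stationarity]).  The point is that one kappa must
    dominate the multipliers of all feasible points at once.  By
    Caratheodory's argument the multipliers may be taken with linearly
    independent gradients of active constraints; each multiplier is then the
    value of -gradient at a dual vector, and there are finitely many dual
    vectors, one for each set of constraints and each of its elements
    ([bounded_farkas]).  The points feasible for the bilevel problem form a
    bounded set because X, Y, U and W are compact and Y_Omega is contained in Y,
    so the values of the gradients at these finitely many vectors, and the
    slacks of the constraints, are bounded uniformly
    ([PB_feasible_bigM_bound]). *)

(** * Farkas' lemma with uniformly bounded multipliers *)

Section Farkas.
Context {R : realType} {V : lmodType R}.
Implicit Types (f c : V -> R).

Lemma scalarD f u v : scalar f -> f (u + v) = f u + f v.
Proof. by move=> lf; rewrite -[u]scale1r lf mul1r scale1r. Qed.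

Lemma scalar0 f : scalar f -> f 0 = 0.
Proof.
by move=> lf; apply: (addrI (f 0)); rewrite -scalarD // !addr0.
Qed.

Lemma scalarZ f k u : scalar f -> f (k *: u) = k * f u.
Proof. by move=> lf; rewrite -[k *: u]addr0 lf scalar0 // addr0. Qed.

Lemma scalarN f u : scalar f -> f (- u) = - f u.
Proof. by move=> lf; rewrite -scaleN1r scalarZ // mulN1r. Qed.

(** Bartl's proof, by induction on the number of functionals: if the direction
    [d] that separates [c] from the first functionals violates the new one,
    [a i0 d > 0], replace every functional by its combination with [a i0] that
    vanishes at [d] and use the induction hypothesis again.  With functionals on
    an arbitrary module, the lemma applies directly to input sequences. *)
Lemma farkas (I : finType) (s : seq I) (a : I -> V -> R) c :
  (forall i, scalar (a i)) -> scalar c ->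
  (exists l : I -> R, [/\ forall i, 0 <= l i, forall i, i \notin s -> l i = 0 &
     forall v, c v = \sum_i l i * a i v]) \/
  (exists2 d, forall i, i \in s -> a i d <= 0 & 0 < c d).
Proof.
elim: s a c => [|i0 s IHs] a c la lc.
  have [c0|/existsNP[d /eqP cd0]] := pselect (forall v, c v = 0).
    left; exists (fun=> 0); split=> // v.
    by rewrite c0 big1 // => i _; rewrite mul0r.
  right; exists (c d *: d) => //.
  by rewrite scalarZ // -expr2 exprn_even_gt0.
have [[l [l0 ls lE]]|[d ad cd]] := IHs a c la lc.
  left; exists l; split=> // i.
  by rewrite inE negb_or => /andP[_ /ls].
have [ad0|ad0] := leP (a i0 d) 0.
  by right; exists d => // i; rewrite inE => /predU1P[->//|/ad].
set k := a i0 d in ad0.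
pose a' i v := k * a i v - a i d * a i0 v.
pose c' v := k * c v - c d * a i0 v.
have la' i : scalar (a' i).
  by move=> t u v; rewrite /a' !la; ring.
have lc' : scalar c' by move=> t u v; rewrite /c' !la lc; ring.
have [[l [l0 ls lE]]|[e ae ce]] := IHs a' c' la' lc'.
  (* the coefficient of [a i0] when [k * c = c' + c d * a i0] is expanded and
     divided by [k] *)
  pose t := (c d - \sum_i l i * a i d) / k.
  have t0 : 0 <= t.
    apply: divr_ge0; last exact: ltW.
    rewrite subr_ge0; apply: le_trans (ltW cd).
    apply: sumr_le0 => i _; have [/ad adi|/ls->] := boolP (i \in s).
      exact: mulr_ge0_le0.
    by rewrite mul0r.
  left; exists (fun i => l i + (i == i0)%:R * t); split=> [i|i|v].
  - by rewrite addr_ge0 // mulr_ge0.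
  - rewrite inE negb_or => /andP[/negbTE-> /ls->].
    by rewrite mul0r addr0.
  have kN0 : k != 0 by rewrite gt_eqF.
  apply: (mulfI kN0); rewrite -[LHS](subrK (c d * a i0 v)) -/(c' v) lE.
  under eq_bigr do rewrite mulrBr mulrCA mulrA [l _ * (_ * _)]mulrA.
  under [in RHS]eq_bigr do rewrite mulrDl -mulrA.
  rewrite sumrB big_split mulrDr /=.
  have -> : \sum_i (i == i0)%:R * (t * a i v) = t * a i0 v.
    rewrite (bigD1 i0) //= eqxx mul1r big1 ?addr0 // => i /negbTE->.
    by rewrite mul0r.
  rewrite -mulr_suml mulr_sumr /t.
  under eq_bigr do rewrite -mulrA.
  by field.
right; exists (k *: e - a i0 e *: d) => [i|].
  rewrite scalarD // scalarN // !scalarZ // inE => /predU1P[->|/ae].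
    by rewrite mulrC subrr.
  by rewrite /a' [a i d * _]mulrC.
by rewrite scalarD // scalarN // !scalarZ // [_ * c d]mulrC.
Qed.

(** Farkas' lemma for the functionals [a i] and their opposites: nonnegative
    combinations become arbitrary linear combinations. *)
Lemma span_or_dual (I : finType) (T : {set I}) (a : I -> V -> R) c :
  (forall i, scalar (a i)) -> scalar c ->
  (exists2 b : I -> R, forall i, i \notin T -> b i = 0 &
     forall v, c v = \sum_i b i * a i v) \/
  (exists2 d, forall i, i \in T -> a i d = 0 & c d = 1).
Proof.
move=> la lc.
pose a' (ib : I * bool) v := (-1) ^+ ib.2 * a ib.1 v.
have la' ib : scalar (a' ib) by move=> t u v; rewrite /a' la; ring.
have [[l [l0 ls lE]]|[d ad cd]] :=
    farkas (enum [set ib : I * bool | ib.1 \in T]%SET) la' lc.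
  left; exists (fun i => l (i, false) - l (i, true)) => [i iT|v].
    have lT b' : l (i, b') = 0 by apply: ls; rewrite mem_enum inE.
    by rewrite !lT subrr.
  have -> : c v = \sum_i \sum_b l (i, b) * a' (i, b) v.
    by rewrite pair_bigA lE; apply: eq_bigr => -[].
  by apply: eq_bigr => i _; rewrite big_bool /a' /= expr0 expr1; ring.
right; exists ((c d)^-1 *: d) => [i iT|]; last first.
  by rewrite scalarZ // mulVf // gt_eqF.
rewrite scalarZ //; suff -> : a i d = 0 by rewrite mulr0.
apply/eqP; rewrite eq_le.
have:= ad (i, false); rewrite mem_enum inE /a' /= mul1r => ->//=.
by have:= ad (i, true); rewrite mem_enum inE /a' /= mulN1r oppr_le0; apply.
Qed.

(** As long as the functionals with nonzero coefficient satisfy a linear relation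
    [b], subtract the multiple of [b] that first cancels a coefficient. *)
Lemma caratheodory (I : finType) (a : I -> V -> R) c (l : I -> R) :
  (forall i, 0 <= l i) -> (forall v, c v = \sum_i l i * a i v) ->
  exists l' : I -> R,
    [/\ forall i, 0 <= l' i, forall i, l i = 0 -> l' i = 0,
        forall v, c v = \sum_i l' i * a i v &
        forall b : I -> R, (forall i, l' i = 0 -> b i = 0) ->
          (forall v, \sum_i b i * a i v = 0) -> forall i, b i = 0].
Proof.
have [n] := ubnP #|[set i | l i != 0]%SET|.
elim: n l => // n IHn l; rewrite ltnS => len l0 lE.
have [ind|] := pselect (forall b : I -> R, (forall i, l i = 0 -> b i = 0) ->
    (forall v, \sum_i b i * a i v = 0) -> forall i, b i = 0).
  by exists l; split.
move=> /existsNP[b /not_implyP[bl /not_implyP[bE /existsNP[j /eqP bj]]]].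
wlog bj0 : b bl bE bj / 0 < b j => [WL|].
  have [bj0|bj0] := ltP 0 (b j); first exact: (WL b).
  apply: (WL (fun i => - b i)); rewrite ?oppr_eq0 ?oppr_gt0 ?lt_neqAle ?bj//.
    by move=> i /bl->; rewrite oppr0.
  by move=> v; under eq_bigr do rewrite mulNr; rewrite sumrN bE oppr0.
case: (@arg_minP _ _ I j (fun i => 0 < b i) (fun i => l i / b i) bj0).
move=> i bi0 imin.
pose t := l i / b i.
have t0 : 0 <= t by rewrite divr_ge0 // ltW.
pose l1 k := l k - t * b k.
have l1l k : l k = 0 -> l1 k = 0.
  by move=> lk; rewrite /l1 lk bl // mulr0 subrr.
have l1i : l1 i = 0 by rewrite /l1 /t divfK ?subrr // gt_eqF.
have li : l i != 0 by apply: contraTneq bi0 => /bl->; rewrite ltxx.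
have [||v|l2 [? l2l1 ? ?]] := IHn l1.
- apply: leq_trans len; apply: proper_card; apply/properP; split.
    by apply/fintype.subsetP => k; rewrite !inE; apply: contra => /eqP lk; rewrite l1l.
  by exists i; rewrite !inE // l1i eqxx.
- move=> k; rewrite subr_ge0; have [bk|bk] := ltP 0 (b k).
    by rewrite -ler_pdivlMr // imin.
  by apply: le_trans (l0 k); rewrite mulr_ge0_le0.
- under eq_bigr do rewrite mulrBl -mulrA.
  by rewrite sumrB -mulr_sumr bE mulr0 subr0.
by exists l2; split=> // k /l1l/l2l1.
Qed.

(** The bound is by the values of [c] at test vectors that depend on the
    functionals alone, hence it is uniform in [c] and in the subfamily [s].  The
    test vectors are dual to the linearly independent families: when the
    functionals with nonzero coefficient are independent, the coefficient of
    [a i] is the value of [c] at a vector where [a i] is 1 and the others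
    vanish. *)
Lemma bounded_farkas (I : finType) (a : I -> V -> R) :
  (forall i, scalar (a i)) ->
  exists ds : seq V, forall (s : seq I) c, scalar c ->
  (forall d, (forall i, i \in s -> a i d <= 0) -> c d <= 0) ->
  exists l : I -> R, [/\ forall i, 0 <= l i, forall i, i \notin s -> l i = 0,
     forall v, c v = \sum_i l i * a i v &
     forall i, l i <= \sum_(d <- ds) `|c d|].
Proof.
move=> la.
pose dualP (T : {set I}) i d := (forall j, j \in (T :\ i)%SET -> a j d = 0) /\ a i d = 1.
pose dual (Ti : {set I} * I) := xget 0 [set d | dualP Ti.1 Ti.2 d].
exists [seq dual Ti | Ti <- enum {: {set I} * I}] => s c lc cs.
have [[l0 [l00 l0s l0E]]|[d ds cd]] := farkas s la lc; last first.
  by have := cs d ds; rewrite leNgt cd.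
have [l [lge l0l lE ind]] := caratheodory l00 l0E.
exists l; split=> // [i /l0s/l0l//|i].
have [->|li] := eqVneq (l i) 0; first exact: sumr_ge0.
pose T := [set i | l i != 0]%SET.
have Di : dualP T i (dual (T, i)).
  suff : exists d, dualP T i d by case=> d dP; apply: (xgetPex 0); exists d.
  have [[b b0 bE]|[d d0 d1]] := span_or_dual (T :\ i)%SET la (la i); last by exists d.
  have /(_ _ _ i) := ind (fun j => b j - (j == i)%:R).
  rewrite eqxx b0 ?inE ?eqxx // sub0r => abs.
  have /eqP : - 1 = 0 :> R.
    apply: abs => [j lj|v].
      have [ji|_] := eqVneq j i; first by rewrite -ji lj eqxx in li.
      by rewrite subr0 b0 // !inE lj eqxx andbF.
    under eq_bigr do rewrite mulrBl.
    rewrite sumrB -bE (bigD1 i)//= eqxx mul1r big1 ?addr0 ?subrr//.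
    by move=> j /negbTE->; rewrite mul0r.
  by rewrite oppr_eq0 oner_eq0.
have -> : l i = c (dual (T, i)).
  rewrite lE (bigD1 i)//= Di.2 mulr1 big1 ?addr0// => j ji.
  have [->|lj] := eqVneq (l j) 0; first by rewrite mul0r.
  by rewrite Di.1 ?mulr0// !inE ji.
apply: le_trans (ler_norm _) _.
rewrite big_map big_enum (bigD1 (T, i)) //= lerDl.
exact: sumr_ge0.
Qed.

End Farkas.

Section QuadraticProgram.
Context {R : realType} {V : lmodType R} {I : finType}.
Context (a : I -> V -> R) (la : forall i, scalar (a i)).

(** Multipliers at the minimizer [v = 0] of [g + q] under the constraints
    [a i v <= b i].  If [a i d <= 0] for all active [i], small multiples of [d]
    are admissible and there the linear term prevails over the quadratic one, so
    [g d >= 0]; Farkas' lemma then gives the multipliers. *)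
Lemma qp_kkt_bounded :
  exists ds : seq V, forall (b : I -> R) (g q : V -> R),
    scalar g -> (forall t v, q (t *: v) = t ^+ 2 * q v) ->
    (forall i, 0 <= b i) ->
    (forall v, (forall i, a i v <= b i) -> 0 <= g v + q v) ->
  exists l : I -> R, [/\ forall i, 0 <= l i, forall i, b i != 0 -> l i = 0,
     forall v, g v + \sum_i l i * a i v = 0 &
     forall i, l i <= \sum_(d <- ds) `|g d|].
Proof.
have [ds dsP] := bounded_farkas la.
exists ds => b g q lg qZ b0 opt.
have lNg : scalar (fun v => - g v) by move=> t u v; rewrite lg; ring.
have [|l [l0 ls lE lb]] := dsP [seq i <- enum I | b i == 0] _ lNg.
  move=> d ad; rewrite oppr_le0 leNgt; apply/negP => gd.
  (* [K^-1 *: d] satisfies every inactive constraint by the first term, and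
     [q] is negligible against [g] there by the second one *)
  pose K := \sum_i `|a i d| / b i + `|q d| / - g d + 1.
  have gd' : 0 < - g d by rewrite oppr_gt0.
  have s0 : 0 <= \sum_i `|a i d| / b i by apply: sumr_ge0 => i _; rewrite divr_ge0.
  have q0 : 0 <= `|q d| / - g d by rewrite divr_ge0 // ltW.
  have K0 : 0 < K by rewrite ltr_wpDl // addr_ge0.
  have /(opt _) : forall i, a i (K^-1 *: d) <= b i.
    move=> i; rewrite scalarZ // mulrC ler_pdivrMr //.
    have [bi|bi] := eqVneq (b i) 0.
      by rewrite bi mul0r ad // mem_filter bi eqxx mem_enum.
    have bi0 : 0 < b i by rewrite lt_neqAle eq_sym bi b0.
    rewrite mulrC -ler_pdivrMr //; apply: le_trans (_ : `|a i d| / b i <= _).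
      by rewrite ler_pM2r ?invr_gt0 // ler_norm.
    rewrite /K (bigD1 i) //= -!addrA lerDl !addr_ge0 //.
    by apply: sumr_ge0 => j _; rewrite divr_ge0.
  rewrite scalarZ // qZ expr2 -mulrA -mulrDr pmulr_rge0 ?invr_gt0 //.
  rewrite leNgt => /negP; apply.
  rewrite -ltrBrDl sub0r mulrC ltr_pdivrMr //.
  apply: le_lt_trans (ler_norm _) _.
  rewrite -ltr_pdivrMl // mulrC /K.
  by rewrite -addrA ltr_wpDl // ltrDl.
exists l; split=> // [i bi|v|i].
- by apply: ls; rewrite mem_filter negb_and bi.
- by rewrite -lE subrr.
- by apply: le_trans (lb i) _; under eq_bigr do rewrite normrN.
Qed.

Lemma qp_kkt_sufficient (b : I -> R) (g q : V -> R) (l : I -> R) :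
  (forall v, 0 <= q v) -> (forall i, 0 <= l i) ->
  (forall i, l i * b i = 0) -> (forall v, g v + \sum_i l i * a i v = 0) ->
  forall v, (forall i, a i v <= b i) -> 0 <= g v + q v.
Proof.
move=> q0 l0 lb0 stat v av; apply: addr_ge0 => //.
rewrite -[g v](addrK (\sum_i l i * a i v)) stat sub0r oppr_ge0.
apply: sumr_le0 => i _; rewrite -(lb0 i).
exact: ler_wpM2l.
Qed.

End QuadraticProgram.

Section Dot.
Context {R : realType}.

Definition dot n (a b : 'cV[R]_n) : R := (a^T *m b) 0 0.

Lemma dotE n (a b : 'cV[R]_n) : dot a b = \sum_i a i 0 * b i 0.
Proof. by rewrite /dot mxE; apply: eq_bigr => i _; rewrite mxE. Qed.

Lemma dotC n (a b : 'cV[R]_n) : dot a b = dot b a.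
Proof. by rewrite !dotE; apply: eq_bigr => i _; rewrite mulrC. Qed.

Lemma dot_linear n (a : 'cV[R]_n) : scalar (dot a).
Proof. by move=> t u v; rewrite /dot mulmxDr -scalemxAr !mxE. Qed.

Lemma dotDr n (a b c : 'cV[R]_n) : dot a (b + c) = dot a b + dot a c.
Proof. exact: (scalarD _ _ (dot_linear a)). Qed.

Lemma dotDl n (a b c : 'cV[R]_n) : dot (a + b) c = dot a c + dot b c.
Proof. by rewrite ![dot _ c]dotC dotDr. Qed.

Lemma dotZr n t (a b : 'cV[R]_n) : dot a (t *: b) = t * dot a b.
Proof. exact: (scalarZ _ _ (dot_linear a)). Qed.

Lemma dotZl n t (a b : 'cV[R]_n) : dot (t *: a) b = t * dot a b.
Proof. by rewrite dotC dotZr dotC. Qed.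

Lemma dotNl n (a b : 'cV[R]_n) : dot (- a) b = - dot a b.
Proof. by rewrite -scaleN1r dotZl mulN1r. Qed.

Lemma dot0r n (a : 'cV[R]_n) : dot a 0 = 0.
Proof. exact: (scalar0 (dot_linear a)). Qed.

Lemma dot0l n (a : 'cV[R]_n) : dot 0 a = 0.
Proof. by rewrite dotC dot0r. Qed.

Lemma dot_self_eq0 n (a : 'cV[R]_n) : dot a a = 0 -> a = 0.
Proof.
rewrite dotE => /eqP; rewrite psumr_eq0 => [/allP a0|i _]; last first.
  by rewrite -expr2 sqr_ge0.
apply/colP => i; rewrite mxE; apply/eqP.
by rewrite -sqrf_eq0 expr2; apply: a0; rewrite mem_index_enum.
Qed.

Lemma dot_mulmxl m n (M : 'M[R]_(m, n)) a b : dot (M *m a) b = dot a (M^T *m b).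
Proof. by rewrite /dot trmx_mul mulmxA. Qed.

Lemma dot_mulmxr m n (M : 'M[R]_(m, n)) a b : dot a (M *m b) = dot (M^T *m a) b.
Proof. by rewrite dot_mulmxl trmxK. Qed.

Lemma qformE n (M : 'M[R]_n) v : qform M v = dot (M *m v) v.
Proof. by rewrite dotC /qform /dot mulmxA. Qed.

Lemma qformZ n (M : 'M[R]_n) t v : qform M (t *: v) = t ^+ 2 * qform M v.
Proof. by rewrite !qformE -scalemxAr dotZl dotZr; ring. Qed.

Lemma qformD n (M : 'M[R]_n) u v : M^T = M ->
  qform M (u + v) = qform M u + 2 * dot (M *m u) v + qform M v.
Proof.
move=> sM; rewrite !qformE mulmxDr !dotDl !dotDr.
by rewrite [dot (M *m v) u]dotC dot_mulmxr sM; ring.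
Qed.

Lemma pdmx_psd n (M : 'M[R]_n) : pdmx M -> psdmx M.
Proof.
move=> [sM M0]; split=> // v; have [->|/M0/ltW//] := eqVneq v 0.
by rewrite qformE dot0r.
Qed.

End Dot.

(** * The lower-level problem as a quadratic program *)

Section LowerLevel.
Context {R : realType} {rho eta gam om mx my mu mw mo : nat}.
Context (D : bimpc_data R rho eta gam om mx my mu mw mo) (N : nat).
Context (xi0 : 'cV[R]_(rho + eta)).

Local Notation p := (rho + eta)%N.
Local Notation A := (stA D).
Local Notation B2 := (inB2 D).
Local Notation direction := (nat -> 'cV[R]_om).
Implicit Types (v : direction) (xi : N.-tuple 'cV[R]_p).
Implicit Types (u : N.-tuple 'cV[R]_gam) (w : N.-tuple 'cV[R]_om).

(** The change of the states caused by the change [v] of the lower-level inputs,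
    the initial state and [u] being kept. *)
Fixpoint response v n : 'cV[R]_p :=
  if n is k.+1 then A *m response v k + B2 *m v k else 0.

Lemma responseP t v1 v2 n :
  response (t *: v1 + v2) n = t *: response v1 n + response v2 n.
Proof.
elim: n => [|n /= ->]; first by rewrite /= scaler0 addr0.
by rewrite !mulmxDr scalerDr -!scalemxAr addrACA.
Qed.

Lemma responseZ t v n : response (t *: v) n = t *: response v n.
Proof.
elim: n => [|n /= ->]; first by rewrite /= scaler0.
by rewrite scalerDr !scalemxAr.
Qed.

(** The inequality constraints of the lower-level problem: those on [y_n], on
    [y_N] and on [w_n]. *)
Definition constraint : finType := ('I_N * 'I_my + 'I_mo + 'I_N * 'I_mw)%type.

Definition slack xi w (i : constraint) : R :=
  match i with
  | inl (inl (n, i)) => gy D i 0 - (Fy D *m dsubmx (traj xi0 xi n)) i 0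
  | inl (inr i) => go D i 0 - (Fo D *m dsubmx (traj xi0 xi N)) i 0
  | inr (n, i) => gw D i 0 - (Fw D *m w`_n) i 0
  end.

Definition slope (i : constraint) v : R :=
  match i with
  | inl (inl (n, i)) => (Fy D *m dsubmx (response v n)) i 0
  | inl (inr i) => (Fo D *m dsubmx (response v N)) i 0
  | inr (n, i) => (Fw D *m v n) i 0
  end.

Lemma slope_linear i : scalar (slope i).
Proof.
move=> t v1 v2; case: i => [[[n i]|i]|[n i]] /=.
- by rewrite responseP linearP mulmxDr -scalemxAr !mxE.
- by rewrite responseP linearP mulmxDr -scalemxAr !mxE.
- by rewrite mulmxDr -scalemxAr !mxE.
Qed.

(** The derivative of the lower-level cost in the direction [v]. *)
Definition gradient xi u w v : R :=
  2 * dot (loU D *m traj xi0 xi N) (response v N) +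
  \sum_(0 <= n < N) (2 * dot (loV D *m traj xi0 xi n) (response v n) +
                     2 * dot (loW2 D *m w`_n + (loPhi D)^T *m u`_n) (v n)).

Definition curvature v : R :=
  qform (loU D) (response v N) +
  \sum_(0 <= n < N) (qform (loV D) (response v n) + qform (loW2 D) (v n)).

Lemma gradient_linear xi u w : scalar (gradient xi u w).
Proof.
move=> t v1 v2; rewrite /gradient responseP dot_linear.
under eq_bigr do rewrite responseP !dot_linear.
rewrite mulrDr [t * (_ + _)]mulrDr mulr_sumr addrACA -big_split /=.
congr (_ + _ + _); first by ring.
by apply: eq_bigr => n _; ring.
Qed.

Lemma curvatureZ t v : curvature (t *: v) = t ^+ 2 * curvature v.
Proof.
rewrite /curvature responseZ qformZ mulrDr mulr_sumr; congr (_ + _).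
by apply: eq_bigr => n _; rewrite responseZ !qformZ mulrDr.
Qed.

Lemma curvature_ge0 v : psdmx (loU D) -> psdmx (loV D) -> psdmx (loW2 D) ->
  0 <= curvature v.
Proof.
move=> [_ U0] [_ V0] [_ W0]; apply: addr_ge0 => //.
by apply: sumr_ge0 => n _; apply: addr_ge0.
Qed.

Lemma qform_loW_shift (un : 'cV[R]_gam) (wn vn : 'cV[R]_om) : (loW2 D)^T = loW2 D ->
  qform (loW D) (col_mx un (wn + vn)) =
  qform (loW D) (col_mx un wn)
  + 2 * dot (loW2 D *m wn + (loPhi D)^T *m un) vn + qform (loW2 D) vn.
Proof.
move=> sW2; rewrite !qformE /loW !mul_block_col.
have dot_col (a b : 'cV[R]_gam) (c d : 'cV[R]_om) :
    dot (col_mx a c) (col_mx b d) = dot a b + dot c d.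
  by rewrite /dot tr_col_mx mul_row_col mxE.
rewrite !dot_col !mulmxDr !dotDl !dotDr.
rewrite [dot (loW2 D *m vn) wn]dotC dot_mulmxr sW2.
by rewrite [dot (_ *m vn) un]dotC dot_mulmxr; ring.
Qed.

Lemma cost_shift xi u w xi' w' v :
  (loU D)^T = loU D -> (loV D)^T = loV D -> (loW2 D)^T = loW2 D ->
  (forall n, (n <= N)%N -> traj xi0 xi' n = traj xi0 xi n + response v n) ->
  (forall n, (n < N)%N -> w'`_n = w`_n + v n) ->
  cost (loU D) (loV D) (loW D) xi0 xi' u w' =
  cost (loU D) (loV D) (loW D) xi0 xi u w + (gradient xi u w v + curvature v).
Proof.
move=> sU sV sW xiE wE; rewrite /cost /gradient /curvature /input xiE //.
rewrite qformD // [X in _ + X](eq_big_nat _ _ (F2 := fun n =>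
  (qform (loV D) (traj xi0 xi n) + qform (loW D) (col_mx u`_n w`_n)) +
  (2 * dot (loV D *m traj xi0 xi n) (response v n) +
   2 * dot (loW2 D *m w`_n + (loPhi D)^T *m u`_n) (v n)) +
  (qform (loV D) (response v n) + qform (loW2 D) (v n)))); last first.
  move=> n /= nN; rewrite xiE ?(ltnW nN) // wE // qformD // qform_loW_shift //.
  by ring.
by rewrite !big_split /=; ring.
Qed.

Lemma traj_mktuple (X : nat -> 'cV[R]_p) n : X 0 = xi0 -> (n <= N)%N ->
  traj xi0 [tuple X i.+1 | i < N] n = X n.
Proof.
move=> X0; case: n => [|n] nN; rewrite /traj //=.
by rewrite -[n]/(nat_of_ord (Ordinal nN)) nth_mktuple.
Qed.

Lemma nth_mktuple_lt (T : nmodType) (F : nat -> T) n : (n < N)%N ->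
  [tuple F i | i < N]`_n = F n.
Proof. by move=> nN; rewrite -[n]/(nat_of_ord (Ordinal nN)) nth_mktuple. Qed.

Lemma slack_ge0P xi w :
  (forall i, 0 <= slack xi w i) <->
  [/\ forall n, (n < N)%N -> Yset D (dsubmx (traj xi0 xi n)),
      forall n, (n < N)%N -> Wset D w`_n &
      Yoset D (dsubmx (traj xi0 xi N))].
Proof.
split=> [s0|[y0 w0 o0] [[[n i]|i]|[n i]]] /=; rewrite ?subr_ge0.
- split=> [n nN i|n nN i|i]; rewrite -subr_ge0.
  + exact: (s0 (inl (inl (Ordinal nN, i)))).
  + exact: (s0 (inr (Ordinal nN, i))).
  + exact: (s0 (inl (inr i))).
- exact: y0.
- exact: o0.
- exact: w0.
Qed.

Lemma PL_feasibleP xi u w :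
  PL_feasible D xi0 u (xi, w) <->
  dynamics D xi0 xi u w /\ forall i, 0 <= slack xi w i.
Proof.
split=> [[dyn yw o0]|[dyn /slack_ge0P[y0 w0 o0]]].
  by split=> //; apply/slack_ge0P; split=> // n /yw[].
by split=> // n nN; split; [exact: y0|exact: w0].
Qed.

Lemma slack_shift xi w xi' w' v i :
  (forall n, (n <= N)%N -> traj xi0 xi' n = traj xi0 xi n + response v n) ->
  (forall n, (n < N)%N -> w'`_n = w`_n + v n) ->
  slack xi' w' i = slack xi w i - slope i v.
Proof.
move=> xiE wE; case: i => [[[n i]|i]|[n i]] /=.
- by rewrite xiE ?(ltnW (ltn_ord n)) // linearD mulmxDr [in LHS]mxE opprD addrA.
- by rewrite xiE // linearD mulmxDr [in LHS]mxE opprD addrA.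
- by rewrite wE // mulmxDr [in LHS]mxE opprD addrA.
Qed.

Lemma dynamics_shift (x r : 'cV[R]_p) (un : 'cV[R]_gam) (wn vn : 'cV[R]_om) :
  A *m (x + r) + inB D *m col_mx un (wn + vn) =
  A *m x + inB D *m col_mx un wn + (A *m r + B2 *m vn).
Proof.
by rewrite /inB !mul_row_col !mulmxDr [X in _ + X = _]addrA addrACA.
Qed.

(** Optimality of (xi, w) expressed at the origin of the space of perturbations,
    where the inequality constraints are [slope i v <= slack xi w i]. *)
Lemma argmin_PLP xi u w :
  (loU D)^T = loU D -> (loV D)^T = loV D -> (loW2 D)^T = loW2 D ->
  dynamics D xi0 xi u w ->
  argmin_PL D xi0 u (xi, w) <->
  (forall i, 0 <= slack xi w i) /\
  forall v, (forall i, slope i v <= slack xi w i) ->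
    0 <= gradient xi u w v + curvature v.
Proof.
move=> sU sV sW dyn; split=> [[/PL_feasibleP[_ s0] opt]|[s0 opt]].
  split=> // v vs.
  pose xi' := [tuple traj xi0 xi i.+1 + response v i.+1 | i < N].
  pose w' := [tuple w`_i + v i | i < N].
  have xiE n : (n <= N)%N -> traj xi0 xi' n = traj xi0 xi n + response v n.
    move=> nN; apply: (traj_mktuple (X := fun n => traj xi0 xi n + response v n)) => //.
    by rewrite /= addr0.
  have wE n : (n < N)%N -> w'`_n = w`_n + v n.
    exact: (nth_mktuple_lt (fun i => w`_i + v i)).
  have /opt /= : PL_feasible D xi0 u (xi', w').
    apply/PL_feasibleP; split=> [n nN|i]; last first.
      by rewrite (slack_shift _ xiE wE) subr_ge0.
    by rewrite !xiE ?(ltnW nN) // dyn // /input wE // dynamics_shift.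
  by rewrite (cost_shift u sU sV sW xiE wE) lerDl.
split; first exact/PL_feasibleP.
move=> [xi' w'] /PL_feasibleP[dyn' s0'] /=.
pose v n := w'`_n - w`_n.
have wE n : (n < N)%N -> w'`_n = w`_n + v n by rewrite addrC subrK.
have xiE n : (n <= N)%N -> traj xi0 xi' n = traj xi0 xi n + response v n.
  elim: n => [|n IHn] nN; first by rewrite addr0.
  by rewrite dyn' // dyn // IHn ?(ltnW nN) // /input wE // dynamics_shift.
rewrite (cost_shift u sU sV sW xiE wE) lerDl; apply: opt => i.
by rewrite -subr_ge0 -(slack_shift _ xiE wE).
Qed.

(** * Multipliers, costate and stationarity *)

Local Notation aux := (@ip_aux R rho eta my mw mo N).
Implicit Types (d : aux) (l s : constraint -> R) (nu : nat -> 'cV[R]_p).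

(** The inequality multipliers and the binary variables of the integer program,
    read as families over [constraint]. *)
Definition multiplier d (i : constraint) : R :=
  match i with
  | inl (inl (n, i)) => (ip_lam d)`_n i 0
  | inl (inr i) => ip_lamN d i 0
  | inr (n, i) => (ip_gam d)`_n i 0
  end.

Definition indicator d (i : constraint) : R :=
  match i with
  | inl (inl (n, i)) => (ip_sig d)`_n i 0
  | inl (inr i) => ip_sigN d i 0
  | inr (n, i) => (ip_tau d)`_n i 0
  end.

Definition mk_aux nu l s : aux :=
  @IPAux R rho eta my mw mo N [tuple nu n | n < N]
    [tuple \col_i l (inl (inl (n, i))) | n < N] (\col_i l (inl (inr i)))
    [tuple \col_i l (inr (n, i)) | n < N]
    [tuple \col_i s (inl (inl (n, i))) | n < N] (\col_i s (inl (inr i)))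
    [tuple \col_i s (inr (n, i)) | n < N].

Lemma multiplier_mk_aux nu l s i : multiplier (mk_aux nu l s) i = l i.
Proof. by case: i => [[[n i]|i]|[n i]] /=; rewrite ?nth_mktuple mxE. Qed.

Lemma indicator_mk_aux nu l s i : indicator (mk_aux nu l s) i = s i.
Proof. by case: i => [[[n i]|i]|[n i]] /=; rewrite ?nth_mktuple mxE. Qed.

Lemma sum_multiplier_slope d v :
  \sum_i multiplier d i * slope i v =
  dot ((barFo D)^T *m ip_lamN d) (response v N) +
  \sum_(0 <= n < N) (dot ((barFy D)^T *m (ip_lam d)`_n) (response v n) +
                     dot ((Fw D)^T *m (ip_gam d)`_n) (v n)).
Proof.
have barE m (F : 'M[R]_(m, eta)) (r : 'cV[R]_p) : row_mx 0 F *m r = F *m dsubmx r.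
  by rewrite -{1}[r]vsubmxK mul_row_col mul0mx add0r.
rewrite big_split /= !big_mkord !big_sumType /= addrCA addrA.
congr (_ + _ + _).
- transitivity (\sum_(n < N) \sum_i (ip_lam d)`_n i 0 *
    (Fy D *m dsubmx (response v n)) i 0).
    by rewrite pair_bigA; apply: eq_bigr => -[].
  by apply: eq_bigr => n _; rewrite -dot_mulmxr /barFy barE dotE.
- by rewrite -dot_mulmxr /barFo barE dotE.
- transitivity (\sum_(n < N) \sum_i (ip_gam d)`_n i 0 * (Fw D *m v n) i 0).
    by rewrite pair_bigA; apply: eq_bigr => -[].
  by apply: eq_bigr => n _; rewrite -dot_mulmxr dotE.
Qed.

Section Costate.
Context (xi : N.-tuple 'cV[R]_p).
Context (u : N.-tuple 'cV[R]_gam) (w : N.-tuple 'cV[R]_om).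

(** [state_slope], [final_slope] and [input_slope] are the partial gradients of
    the cost plus the inequality terms of the Lagrangian, with respect to [xi_n],
    [xi_N] and [w_n]. *)
Definition state_slope d n : 'cV[R]_p :=
  2 *: (loV D *m traj xi0 xi n) + (barFy D)^T *m (ip_lam d)`_n.

Definition final_slope d : 'cV[R]_p :=
  2 *: (loU D *m traj xi0 xi N) + (barFo D)^T *m ip_lamN d.

Definition input_slope d n : 'cV[R]_om :=
  2 *: (loW2 D *m w`_n) + 2 *: ((loPhi D)^T *m u`_n) + (Fw D)^T *m (ip_gam d)`_n.

Lemma lagrangianE d v :
  gradient xi u w v + \sum_i multiplier d i * slope i v =
  dot (final_slope d) (response v N) +
  \sum_(0 <= n < N) (dot (state_slope d n) (response v n) +
                     dot (input_slope d n) (v n)).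
Proof.
rewrite sum_multiplier_slope /gradient addrACA -big_split /= dotDl dotZl.
congr (_ + _); apply: eq_bigr => n _.
by rewrite !dotDl !dotZl mulrDr; ring.
Qed.

(** Summation by parts: the costate equation for [nu] is the adjoint of the
    recursion that defines [response]. *)
Lemma costate_sum (s nu : nat -> 'cV[R]_p) v k :
  (forall n, (1 <= n <= k)%N -> s n = A^T *m nu n - nu n.-1) ->
  \sum_(0 <= n < k.+1) dot (s n) (response v n) =
  dot (nu k) (response v k.+1) - \sum_(0 <= n < k.+1) dot (B2^T *m nu n) (v n).
Proof.
elim: k => [|k IHk] sE.
  by rewrite !big_nat1 /= mulmx0 add0r dot0r dot_mulmxr subrr.
rewrite big_nat_recr // IHk; last first.
  by move=> n /andP[n1 nk]; apply: sE; rewrite n1 leqW.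
rewrite [in RHS]big_nat_recr // sE ?ltnS ?leqnn //.
have -> : response v k.+2 = A *m response v k.+1 + B2 *m v k.+1 by [].
move: (response v k.+1) => r /=.
by rewrite dotDl dotNl dotDr !dot_mulmxr; ring.
Qed.

Lemma lagrangian_costate d v : (0 < N)%N ->
  final_slope d = - (ip_mu d)`_N.-1 ->
  (forall n, (1 <= n <= N.-1)%N ->
     state_slope d n = A^T *m (ip_mu d)`_n - (ip_mu d)`_n.-1) ->
  gradient xi u w v + \sum_i multiplier d i * slope i v =
  \sum_(0 <= n < N) dot (input_slope d n - B2^T *m (ip_mu d)`_n) (v n).
Proof.
move=> N0 fE sE; rewrite lagrangianE big_split /=.
have := costate_sum v sE; rewrite prednK // => ->.
rewrite fE dotNl; under [in RHS]eq_bigr do rewrite dotDl dotNl.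
by rewrite big_split /= sumrN; ring.
Qed.

Lemma stationarity_lagrangian d : (0 < N)%N ->
  stationarity D xi0 (xi, u, w) d ->
  forall v, gradient xi u w v + \sum_i multiplier d i * slope i v = 0.
Proof.
move=> N0 [st1 st2 st3] v; rewrite lagrangian_costate //.
- rewrite big_nat big1 // => n /= nN.
  have <- : 0 = input_slope d n - B2^T *m (ip_mu d)`_n; last by rewrite dot0l.
  by rewrite -(st3 n nN) addrAC.
- by apply/eqP; rewrite -addr_eq0 -[X in _ == X]st1 addrAC.
- move=> n /st2 st; apply/eqP; rewrite -subr_eq0 -[X in _ == X]st; apply/eqP.
  by rewrite opprB addrACA addrA [RHS]addrAC.
Qed.

(** The backward costate recursion in reversed time, [k] being the number of
    steps before the last index [N.-1].  The record passed to the slopes serves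
    to carry the inequality multipliers [l]. *)
Fixpoint costate_rev l k : 'cV[R]_p :=
  if k is k'.+1 then
    A^T *m costate_rev l k' - state_slope (mk_aux (fun=> 0) l l) (N - k)
  else - final_slope (mk_aux (fun=> 0) l l).

Definition costate l n := costate_rev l (N.-1 - n).

(** The costate equations hold by construction of [mu].  The Lagrangian is then
    the functional [v |-> sum_n dot (r_n) (v_n)], with [r_n] the residual of the
    stationarity condition in [w_n]; evaluating it at [v = r] gives [r = 0]. *)
Lemma lagrangian_stationarity l s : (0 < N)%N ->
  (forall v, gradient xi u w v + \sum_i l i * slope i v = 0) ->
  stationarity D xi0 (xi, u, w) (mk_aux (costate l) l s).
Proof.
move=> N0 lag; set d := mk_aux _ _ _.
have muE n : (n < N)%N -> (ip_mu d)`_n = costate l n by move/nth_mktuple_lt->.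
have fE : final_slope d = - (ip_mu d)`_N.-1.
  by rewrite muE ?prednK // /costate subnn /= opprK.
have sE n : (1 <= n <= N.-1)%N ->
    state_slope d n = A^T *m (ip_mu d)`_n - (ip_mu d)`_n.-1.
  move=> /andP[n1 nN].
  have nN' : (n < N)%N by rewrite -(prednK N0) ltnS.
  rewrite !muE ?(leq_ltn_trans (leq_pred _)) // /costate.
  have -> : (N.-1 - n.-1 = (N.-1 - n).+1)%N by lia.
  rewrite /=; have -> : (N - (N.-1 - n).+1 = n)%N by lia.
  by rewrite opprB addrCA subrr addr0.
have res0 n : (n < N)%N -> input_slope d n - B2^T *m (ip_mu d)`_n = 0.
  move=> nN; pose r k := input_slope d k - B2^T *m (ip_mu d)`_k.
  have := lagrangian_costate r N0 fE sE.
  under eq_bigr do rewrite multiplier_mk_aux.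
  rewrite lag big_mkord => /esym/eqP; rewrite psumr_eq0 => [/allP r0|k _]; last first.
    by rewrite dotE; apply: sumr_ge0 => i _; rewrite -expr2 sqr_ge0.
  apply/dot_self_eq0/eqP.
  by have := r0 (Ordinal nN) (mem_index_enum _).
split=> [|n nN|n nN].
- by rewrite addrAC; apply/eqP; rewrite addr_eq0; apply/eqP.
- rewrite -[RHS](subrr (state_slope d n)) {2}sE // opprB addrACA addrA.
  by rewrite [RHS]addrAC.
- by rewrite addrAC res0.
Qed.

End Costate.

(** * The integer program in terms of constraints *)

Lemma big_MP kappa xi u w d :
  big_M D kappa xi0 (xi, u, w) d <->
  forall i, multiplier d i <= kappa * indicator d i /\
            slack xi w i <= kappa * (1 - indicator d i).
Proof.
have flip (x g f : R) : (- x <= f - g) = (g - f <= x) by rewrite -opprB lerN2.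
split=> [[y_ o_ w_] [[[n i]|i]|[n i]]|M].
- have [/(_ i) + /(_ i)] := y_ n (ltn_ord n).
  by rewrite /= !mxE flip; split.
- have [/(_ i) + /(_ i)] := o_.
  by rewrite /= !mxE flip; split.
- have [/(_ i) + /(_ i)] := w_ n (ltn_ord n).
  by rewrite /= !mxE flip; split.
split=> [n nN||n nN]; split=> i.
- by have [] := M (inl (inl (Ordinal nN, i))); rewrite !mxE.
- by have [] := M (inl (inl (Ordinal nN, i))); rewrite /= !mxE flip.
- by have [] := M (inl (inr i)); rewrite !mxE.
- by have [] := M (inl (inr i)); rewrite /= !mxE flip.
- by have [] := M (inr (Ordinal nN, i)); rewrite !mxE.
- by have [] := M (inr (Ordinal nN, i)); rewrite /= !mxE flip.
Qed.

Lemma ip_sign_constraintsP d :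
  ip_sign_constraints d <->
  forall i, 0 <= multiplier d i /\ (indicator d i = 0 \/ indicator d i = 1).
Proof.
split=> [[l0 lN0 sb sN] [[[n i]|i]|[n i]]|h].
- have [/(_ i) + _] := l0 n (ltn_ord n); have [/(_ i) + _] := sb n (ltn_ord n).
  by rewrite mxE.
- by have := lN0 i; have := sN i; rewrite mxE.
- have [_ /(_ i) +] := l0 n (ltn_ord n); have [_ /(_ i) +] := sb n (ltn_ord n).
  by rewrite mxE.
split=> [n nN||n nN|].
- split=> i; rewrite mxE.
  + by have [] := h (inl (inl (Ordinal nN, i))).
  + by have [] := h (inr (Ordinal nN, i)).
- by move=> i; rewrite mxE; have [] := h (inl (inr i)).
- split=> i.
  + by have [] := h (inl (inl (Ordinal nN, i))).
  + by have [] := h (inr (Ordinal nN, i)).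
- by move=> i; have [] := h (inl (inr i)).
Qed.

Lemma ip_primal_constraintsP H xi u w :
  ip_primal_constraints D H xi0 (xi, u, w) <->
  [/\ dynamics D xi0 xi u w, lyap_decrease H xi0 xi,
      forall n, (n < N)%N -> Xset D (usubmx (traj xi0 xi n)) /\ Uset D u`_n,
      Xset D (usubmx (traj xi0 xi N)) & forall i, 0 <= slack xi w i].
Proof.
split=> [[dyn lyap c xN oN]|[dyn lyap c xN /slack_ge0P[y0 w0 o0]]].
  split=> //; first by move=> n /c[].
  by apply/slack_ge0P; split=> // n /c[].
split=> // n nN; have [? ?] := c n nN.
by split=> //; [exact: y0|exact: w0].
Qed.

Section Optimality.
Context (H : 'M[R]_p).
Context (U_psd : psdmx (loU D)) (V_psd : psdmx (loV D)) (W2_pd : pdmx (loW2 D)).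
Context (N_ge1 : (1 <= N)%N).

(** An indicator equal to 0 forces the multiplier to vanish, an indicator equal to
    1 forces the slack to vanish: this is complementarity, whatever [kappa]. *)
Lemma PIP_feasible_PB_feasible kappa z d :
  PIP_feasible D H kappa xi0 (z, d) -> PB_feasible D H xi0 z.
Proof.
case: z => [[xi u] w] [/= st /big_MP bM /ip_primal_constraintsP[dyn lyap c xN s0]].
move=> /ip_sign_constraintsP sg.
split=> //; apply/argmin_PLP => //; [by case: U_psd|by case: V_psd|by case: W2_pd|].
split=> //; apply: (qp_kkt_sufficient (l := multiplier d)).
- by move=> v; apply: curvature_ge0 => //; exact: pdmx_psd.
- by move=> i; have [] := sg i.
- move=> i; have [l0 sb] := sg i; have [lk sk] := bM u i.
  case: sb => sb; rewrite sb in lk sk; apply/eqP; rewrite mulf_eq0 !eq_le.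
    by rewrite l0 andbT -[X in _ <= X](mulr0 kappa) lk.
  rewrite s0 !andbT -[X in slack _ _ _ <= X](mulr0 kappa).
  by rewrite -[X in kappa * X](subrr 1) sk orbT.
- exact: stationarity_lagrangian st.
Qed.

(** The multipliers come from [qp_kkt_bounded] and the indicator of a constraint
    is 1 when it is active.  [kappa] has to exceed the multipliers of the active
    constraints and the slacks of the inactive ones. *)
Lemma PB_feasible_PIP_feasible :
  exists ds : seq direction, forall kappa z, PB_feasible D H xi0 z ->
    (forall i, slack z.1.1 z.2 i <= kappa) ->
    \sum_(v <- ds) `|gradient z.1.1 z.1.2 z.2 v| <= kappa ->
    exists d, PIP_feasible D H kappa xi0 (z, d).
Proof.
have [ds dsP] := qp_kkt_bounded slope_linear.
exists ds => kappa [[xi u] w] [opt lyap c xN] sk gk /=.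
have [[dyn _ _] _] := opt.
move: opt => /argmin_PLP[]//; [by case: U_psd|by case: V_psd|by case: W2_pd|].
move=> s0 opt.
have [l [l0 ls lag lb]] := dsP (slack xi w) _ _ (gradient_linear xi u w)
  curvatureZ s0 opt.
pose s i : R := (slack xi w i == 0)%:R.
exists (mk_aux (costate xi l) l s); split.
- exact: lagrangian_stationarity.
- apply/big_MP => i; rewrite multiplier_mk_aux indicator_mk_aux /s.
  have [->|si] := eqVneq (slack xi w i) 0.
    by rewrite mulr1 subrr mulr0; split=> //; apply: le_trans (lb i) gk.
  by rewrite mulr0 subr0 mulr1 ls //; split=> //; exact: sk.
- by apply/ip_primal_constraintsP.
- apply/ip_sign_constraintsP => i; rewrite multiplier_mk_aux indicator_mk_aux.
  by split=> //; rewrite /s; case: eqP; [right|left].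
Qed.

End Optimality.

(** * Uniform bounds on the feasible set *)

Definition bounded_on (T : Type) (S : set T) (f : T -> R) : Prop :=
  exists K, forall z, S z -> `|f z| <= K.

Section BoundedOn.
Context (T : Type) (S : set T).

Lemma bounded_on_cst c : bounded_on S (fun=> c).
Proof. by exists `|c|. Qed.

Lemma bounded_onD f g :
  bounded_on S f -> bounded_on S g -> bounded_on S (fun z => f z + g z).
Proof.
move=> [K1 f1] [K2 g2]; exists (K1 + K2) => z Sz.
by apply: le_trans (ler_normD _ _) _; apply: lerD; [exact: f1|exact: g2].
Qed.

Lemma bounded_onM f g :
  bounded_on S f -> bounded_on S g -> bounded_on S (fun z => f z * g z).
Proof.
move=> [K1 f1] [K2 g2]; exists (K1 * K2) => z Sz.
by rewrite normrM; apply: ler_pM => //; [exact: f1|exact: g2].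
Qed.

Lemma bounded_on_sum (I : eqType) (r : seq I) (f : I -> T -> R) :
  (forall i, i \in r -> bounded_on S (f i)) ->
  bounded_on S (fun z => \sum_(i <- r) f i z).
Proof.
elim: r => [|i r IHr] fb.
  by exists 0 => z _; rewrite big_nil normr0.
have [||K fK] := bounded_onD (f := f i) (g := fun z => \sum_(i <- r) f i z).
- by apply: fb; rewrite mem_head.
- by apply: IHr => j jr; apply: fb; rewrite inE jr orbT.
by exists K => z; rewrite big_cons; exact: fK.
Qed.

Lemma bounded_on_norm f : bounded_on S f -> bounded_on S (fun z => `|f z|).
Proof. by move=> [K fK]; exists K => z /fK; rewrite normr_id. Qed.

Definition coord_bounded n (f : T -> 'cV[R]_n) : Prop :=
  forall i, bounded_on S (fun z => f z i 0).

Lemma coord_bounded_dot n (f : T -> 'cV[R]_n) b :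
  coord_bounded f -> bounded_on S (fun z => dot (f z) b).
Proof.
move=> fb.
have [i _|K fK] := bounded_on_sum (r := enum 'I_n)
    (f := fun i z => f z i 0 * b i 0).
  by apply: bounded_onM => //; exact: bounded_on_cst.
by exists K => z /fK; rewrite dotE big_enum.
Qed.

Lemma coord_bounded_mulmx m n (M : 'M[R]_(m, n)) f :
  coord_bounded f -> coord_bounded (fun z => M *m f z).
Proof.
move=> fb i; have [K fK] := coord_bounded_dot (row i M)^T fb.
exists K => z /fK; rewrite dotC dotE mxE.
by under eq_bigr do rewrite !mxE.
Qed.

Lemma coord_boundedD n (f g : T -> 'cV[R]_n) :
  coord_bounded f -> coord_bounded g -> coord_bounded (fun z => f z + g z).
Proof.
move=> fb gb i; have [K fK] := bounded_onD (fb i) (gb i).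
by exists K => z /fK; rewrite mxE.
Qed.

Lemma coord_bounded_compact n (C : set 'cV[R]_n) (f : T -> 'cV[R]_n) :
  compact C -> (forall z, S z -> C (f z)) -> coord_bounded f.
Proof.
move=> /compact_bounded[M [_ /(_ (M + 1))]].
rewrite ltrDl ltr01 => /(_ isT) CM SC i; exists (M + 1) => z /SC/CM /=.
apply: le_trans; rewrite [leRHS]mx_normrE.
exact: (le_bigmax _ (fun ij => `|f z ij.1 ij.2|) (i, 0)).
Qed.

Lemma coord_bounded_col m n (f : T -> 'cV[R]_(m + n)) :
  coord_bounded (fun z => usubmx (f z)) -> coord_bounded (fun z => dsubmx (f z)) ->
  coord_bounded f.
Proof.
move=> ub db i; rewrite -(splitK i); case: (fintype.split i) => j /=.
- by have [K uK] := ub j; exists K => z /uK; rewrite mxE.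
- by have [K dK] := db j; exists K => z /dK; rewrite mxE.
Qed.

End BoundedOn.

Section Bounds.
Context (H : 'M[R]_p).
Context (X_compact : compact (Xset D)) (Y_compact : compact (Yset D)).
Context (U_compact : compact (Uset D)) (W_compact : compact (Wset D)).
Context (Yo_sub : Yoset D `<=` Yset D).

Let S : set (primal N) := PB_feasible D H xi0.

(** [y_N] is bounded because [Y_Omega] is contained in the compact set [Y]. *)
Lemma traj_coord_bounded n : (n <= N)%N ->
  coord_bounded S (fun z => traj xi0 z.1.1 n).
Proof.
move=> nN; apply: coord_bounded_col.
- apply: coord_bounded_compact X_compact _ => -[[xi u] w] [_ _ xu xN] /=.
  by move: nN; rewrite leq_eqVlt => /predU1P[->//|/xu[]].
- apply: coord_bounded_compact Y_compact _ => -[[xi u] w] [[[_ yw yN] _] _ _ _] /=.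
  by move: nN; rewrite leq_eqVlt => /predU1P[->|/yw[]//]; exact: Yo_sub.
Qed.

Lemma upper_input_coord_bounded n : (n < N)%N -> coord_bounded S (fun z => z.1.2`_n).
Proof.
move=> nN; apply: coord_bounded_compact U_compact _ => -[[xi u] w] [_ _ xu _] /=.
by have [] := xu n nN.
Qed.

Lemma lower_input_coord_bounded n : (n < N)%N -> coord_bounded S (fun z => z.2`_n).
Proof.
move=> nN; apply: coord_bounded_compact W_compact _.
move=> -[[xi u] w] [[[_ yw _] _] _ _ _] /=.
by have [] := yw n nN.
Qed.

Lemma slack_bounded i : bounded_on S (fun z => slack z.1.1 z.2 i).
Proof.
have aux k n (F : 'M[R]_(k, n)) g j f : coord_bounded S f ->
    bounded_on S (fun z => g j 0 - (F *m f z) j 0).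
  move=> fb; apply: bounded_onD; first exact: bounded_on_cst.
  have [K fK] := coord_bounded_mulmx F fb j.
  by exists K => z /fK; rewrite normrN.
have dsub n : (n <= N)%N -> coord_bounded S (fun z => dsubmx (traj xi0 z.1.1 n)).
  move=> nN j; have [K fK] := traj_coord_bounded nN (rshift rho j).
  by exists K => z /fK; rewrite mxE.
case: i => [[[n i]|i]|[n i]] /=; apply: aux.
- exact/dsub/ltnW.
- exact: dsub.
- exact: lower_input_coord_bounded.
Qed.

Lemma gradient_bounded v :
  bounded_on S (fun z => gradient z.1.1 z.1.2 z.2 v).
Proof.
apply: bounded_onD.
  apply: bounded_onM; first exact: bounded_on_cst.
  by apply/coord_bounded_dot/coord_bounded_mulmx/traj_coord_bounded.
apply: bounded_on_sum => n; rewrite mem_index_iota => /andP[_ nN].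
apply: bounded_onD; apply: bounded_onM; try exact: bounded_on_cst.
  by apply/coord_bounded_dot/coord_bounded_mulmx/traj_coord_bounded/ltnW.
apply/coord_bounded_dot/coord_boundedD; apply/coord_bounded_mulmx.
- exact: lower_input_coord_bounded.
- exact: upper_input_coord_bounded.
Qed.

Lemma PB_feasible_bigM_bound (ds : seq direction) :
  exists K, forall z, PB_feasible D H xi0 z ->
    (forall i, slack z.1.1 z.2 i <= K) /\
    \sum_(v <- ds) `|gradient z.1.1 z.1.2 z.2 v| <= K.
Proof.
have [i _|K1 sK] := bounded_on_sum (S := S) (r := enum constraint)
    (f := fun i z => `|slack z.1.1 z.2 i|).
  exact/bounded_on_norm/slack_bounded.
have [v _|K2 gK] := bounded_on_sum (S := S) (r := ds)
    (f := fun v z => `|gradient z.1.1 z.1.2 z.2 v|).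
  exact/bounded_on_norm/gradient_bounded.
exists (Num.max K1 K2) => z Sz; split=> [i|].
- rewrite le_max; apply/orP; left; apply: le_trans (ler_norm _) _.
  apply: le_trans (sK z Sz); apply: le_trans (ler_norm _).
  by rewrite big_enum (bigD1 i) //= lerDl sumr_ge0.
- by rewrite le_max; apply/orP; right; apply: le_trans (ler_norm _) (gK z Sz).
Qed.

End Bounds.
End LowerLevel.

(** * Equality of the sets of minimizers *)

Lemma argmin_projection (R : realType) (T A : Type) (S : set T)
    (S' : set (T * A)) (f : T -> R) :
  (forall z, S z <-> exists d, S' (z, d)) ->
  argmin S f = fst @` argmin S' (fun zd => f zd.1).
Proof.
move=> SS'; apply/seteqP; split=> [z [/SS'[d S'd] zmin]|_ [[z d] [S'zd zmin] <-]].
  exists (z, d) => //; split=> // -[z' d'] S'z' /=.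
  by apply: zmin; apply/SS'; exists d'.
by split=> [|z' /SS'[d' /zmin]//]; apply/SS'; exists d.
Qed.

Theorem theorem3 (R : realType) (rho eta gam om mx my mu mw mo : nat)
    (D : bimpc_data R rho eta gam om mx my mu mw mo) (N : nat)
    (KL : 'M[R]_(om, rho + eta)) (G : 'M[R]_(gam, rho + eta))
    (H : 'M[R]_(rho + eta)) (xi0 : 'cV[R]_(rho + eta))
    (N_ge1 : (1 <= N)%N)
    (X_polytope : polytope_with_origin (Xset D))
    (Y_polytope : polytope_with_origin (Yset D))
    (U_polytope : polytope_with_origin (Uset D))
    (W_polytope : polytope_with_origin (Wset D))
    (U_psd : psdmx (loU D)) (V_psd : psdmx (loV D)) (W2_pd : pdmx (loW2 D))
    (P_psd : psdmx (upP D)) (Q_psd : psdmx (upQ D)) (R_psd : psdmx (upR D))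
    (Yo_terminal : terminal_set D KL)
    (Z_stable : schur_stable (Zmx D N G))
    (H_pd : pdmx H)
    (H_lyapunov : (Zmx D N G)^T *m H *m Zmx D N G - H = - 1%:M) :
  \forall kappa \near +oo,
    argmin_PB D N H xi0 = argmin_PIP D N H kappa xi0.
Proof.
have [ds dsP] := PB_feasible_PIP_feasible xi0 H U_psd V_psd W2_pd N_ge1.
have [[cX _ _] [cY _ _]] := (X_polytope, Y_polytope).
have [[cU _ _] [cW _ _]] := (U_polytope, W_polytope).
have [YoY _ _] := Yo_terminal.
have [K KP] := PB_feasible_bigM_bound N xi0 H cX cY cU cW YoY ds.
near=> kappa.
have Kk : K <= kappa by near: kappa; apply: nbhs_pinfty_ge; exact: num_real.
apply: argmin_projection => z; split=> [Sz|[d]].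
  have [sK gK] := KP z Sz.
  by apply: dsP => // [i|]; apply: le_trans Kk.
exact: PIP_feasible_PB_feasible.
Unshelve. all: by end_near.
Qed.
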